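(* Every finite quadratical quasigroup has order $1+4n$ for some $n\in\{0,1,2,\dots\}$.
   Context: A groupoid is a nonempty set with a binary operation, written as juxtaposition. A groupoid $G$ is right solvable if for all $a,b\in G$ there is a unique $x\in G$ with $ax=b$. It has property A if $(xy)x=(zx)(yz)$ for all $x,y,z\in G$. A quadratical quasigroup is a right solvable groupoid with property A (such a groupoid is known to be a quasigroup). *)

(* Defs.v *)
From mathcomp Require Import all_boot.
Set Implicit Arguments.
Unset Strict Implicit.
Unset Printing Implicit Defensive.

Definition right_solvable (G : Type) (op : G -> G -> G) : Prop :=
  forall a b : G, exists! x : G, op a x = b.

Definition property_A (G : Type) (op : G -> G -> G) : Prop :=
  forall x y z : G, op (op x y) x = op (op z x) (op y z).

(* Groupoids are nonempty by definition, hence [inhabited G]. *)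
Definition quadratical_quasigroup (G : Type) (op : G -> G -> G) : Prop :=
  [/\ inhabited G, right_solvable op & property_A op].

(* Main.v *)
Require Import Defs.
From mathcomp Require Import all_boot.
Set Implicit Arguments.
Unset Strict Implicit.
Unset Printing Implicit Defensive.

(** The model to keep in mind is the complex plane, where [op x y] is the
centre of the positively oriented square with edge from [x] to [y].  Fix a
centre [a].  Then sending [x] to the unique [y] with [op x y = a] is the
quarter turn about [a].  Two facts about the plane survive in every
quadratical quasigroup: four quarter turns make the identity
([square_closes]), and the half turn fixes nothing but [a]
([op_anticommutative]).  Hence all orbits of the quarter turn other than
[{a}] have exactly four elements, and the order is congruent to 1 modulo 4
([card_quarter_turn]). *)

Section QuadraticalQuasigroup.

Variables (G : Type) (op : G -> G -> G).
Hypotheses (solv : right_solvable op) (propA : property_A op).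

Local Notation "x * y" := (op x y).

Lemma op_left_cancel a : injective (op a).
Proof.
move=> x y exy; have [z [_ z_uniq]] := solv a (a * y).
by rewrite -(z_uniq x exy); apply: z_uniq.
Qed.

Lemma op_idempotent x : x * x = x.
Proof. by apply: (@op_left_cancel (x * x)); rewrite -propA. Qed.

Lemma op_elastic x y : (x * y) * x = x * (y * x).
Proof. by rewrite (propA x y x) op_idempotent. Qed.

(** In the plane, the squares built on the two sides of the segment from [x]
to [y] have centres which, together with [x] and [y], form a square with
centre the midpoint of [x] and [y]; dually, [x] is the centre of a square
having these two centres as an edge. *)
Lemma op_bookend x y : (y * x) * (x * y) = x.
Proof. by rewrite -propA !op_idempotent. Qed.

Lemma op_anticommutative x y : x * y = y * x -> x = y.
Proof.
move=> exy; rewrite -[LHS](op_bookend x y) -[RHS](op_bookend y x).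
by rewrite exy.
Qed.

Lemma op_right_cancel c : injective (op^~ c).
Proof.
move=> x y /= exy.
(* By property A, agreement of [x] and [y] at one right factor spreads to
   all right factors. *)
have eqz z : x * z = y * z.
  by apply: (@op_left_cancel (z * c)); rewrite -!propA !op_elastic exy.
have yxE : y * x = x by rewrite -eqz op_idempotent.
have xyE : x * y = y by rewrite eqz op_idempotent.
by have := op_bookend x y; rewrite yxE xyE xyE.
Qed.

(** The element [(x * z) * x] plays the role of the midpoint of [x] and [z]:
the diagonal of a square has the centre of the square as its midpoint. *)
Lemma diagonal_midpoint a x y z : x * y = a -> y * z = a -> (x * z) * x = a.
Proof.
move=> xy yz; rewrite (propA x z y).
set p := y * x; set q := z * y.
have ap : a * p = y by rewrite -xy op_bookend.
have qa : q * a = y by rewrite -yz op_bookend.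
(* Since [a * p = q * a], property A computes
   [(a * p) * (p * q) = (q * a) * (p * q) = (a * p) * a]. *)
by apply: (@op_left_cancel (a * p)); rewrite {1}ap -qa -propA.
Qed.

(** Property A sends the claim back to the midpoint of the diagonal:
[(t * x) * a = (t * x) * (z * t) = (x * z) * x = a = a * a]. *)
Lemma square_closes a x y z t :
  x * y = a -> y * z = a -> z * t = a -> t * x = a.
Proof.
move=> xy yz zt; apply: (@op_right_cancel a) => /=.
by rewrite op_idempotent -{1}zt -propA (diagonal_midpoint xy yz).
Qed.

End QuadraticalQuasigroup.

(** The four points [x], [f x], [f (f x)], [f (f (f x))] are distinct for
[x <> a], because any coincidence among them gives a fixed point of
[f \o f] in the orbit of [x], and the orbit of [x] avoids [a]. *)
Lemma card_quarter_turn (T : finType) (f : T -> T) (a : T) :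
    (forall x, f (f (f (f x))) = x) -> f a = a ->
    (forall x, f (f x) = x -> x = a) ->
  exists n, #|T| = 1 + 4 * n.
Proof.
move=> f4 fa f2.
have injf : injective f by apply: (can_inj (g := f \o f \o f)) => x; apply: f4.
have f_neq x : x != a -> f x != a by rewrite -{2}fa (inj_eq injf).
have f1_neq x : x != a -> x != f x.
  by apply: contraNneq => xf; apply/eqP/f2; rewrite -!xf.
have f2_neq x : x != a -> x != f (f x).
  by apply: contraNneq => xf; apply/eqP/f2.
have order4 : predC1 a \subset order_set f 4.
  apply/subsetP=> x; rewrite !inE => xa.
  rewrite (@order_cycle _ f [:: x; f x; f (f x); f (f (f x))]) ?mem_head //.
    by rewrite /= f4 !eqxx.
  have f3_neq : x != f (f (f x)).
    by rewrite -[X in X != _]f4 eq_sym f1_neq ?f_neq.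
  by rewrite /= !inE !negb_or !(f1_neq, f2_neq, f_neq, f3_neq).
have closed : fclosed f (predC1 a).
  by move=> x _ /eqP <-; rewrite !inE -{2}fa (inj_eq injf).
exists (fcard f (predC1 a)).
rewrite mulnC (fcard_order_set injf order4 closed).
by rewrite -(cardC (pred1 a)) card1.
Qed.

Theorem proposition3p4 (G : finType) (op : G -> G -> G)
    (hG : quadratical_quasigroup op) :
  exists n : nat, #|G| = 1 + 4 * n.
Proof.
case: hG => -[a] solv propA.
pose turn x := odflt x [pick y | op x y == a].
have turnP x : op x (turn x) = a.
  rewrite /turn; case: pickP => [y /eqP //|no_y].
  by have [y [/eqP xy _]] := solv x a; rewrite no_y in xy.
have turnE x y : op x y = a -> turn x = y.
  by move=> xy; apply: (op_left_cancel solv (a := x)); rewrite turnP.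
apply: (@card_quarter_turn _ turn a) => [x||x turn2].
- by apply/turnE/(square_closes solv propA (turnP _) (turnP _) (turnP _)).
- exact/turnE/op_idempotent.
- have yx : op (turn x) x = a by rewrite -{2}turn2 turnP.
  have xE : x = turn x.
    by apply: (op_anticommutative solv propA); rewrite turnP yx.
  by rewrite -(turnP x) -xE op_idempotent.
Qed.
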